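(* Suppose that both $G$ and its complement $\overline{G}$ are connected graphs on $n$ vertices, and let $k$ be an integer. (i) For $n=5$, $mvx_k(G)+mvx_k(\overline{G})\geq 6$ for $3\leq k\leq 5$. (ii) For $n=6$, $mvx_k(G)+mvx_k(\overline{G})\geq 8$ for $3\leq k\leq 6$. (iii) For $n\geq 7$: if $n$ is odd, then $mvx_k(G)+mvx_k(\overline{G})\geq n+3$ for $3\leq k\leq \frac{n-1}{2}$, and $mvx_k(G)+mvx_k(\overline{G})\geq n+2$ for $\frac{n+1}{2}\leq k\leq n$; if $n=4t$ for an integer $t$, then $mvx_k(G)+mvx_k(\overline{G})\geq n+3$ for $3\leq k\leq \frac{n}{2}-1$, and $mvx_k(G)+mvx_k(\overline{G})\geq n+2$ for $\frac{n}{2}\leq k\leq n$; if $n=4t+2$ for an integer $t$, then $mvx_k(G)+mvx_k(\overline{G})\geq n+3$ for $3\leq k\leq \frac{n}{2}$, and $mvx_k(G)+mvx_k(\overline{G})\geq n+2$ for $\frac{n}{2}+1\leq k\leq n$. Moreover, all the lower bounds on $mvx_k(G)+mvx_k(\overline{G})$ in (i), (ii) and (iii) are sharp.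
   Context: All graphs are simple, finite and undirected. Colorings are arbitrary (not necessarily proper). A tree $T$ that is a subgraph of a vertex-colored graph $H$ is a vertex-monochromatic tree if all internal (non-leaf) vertices of $T$ have the same color. For $S\subseteq V(H)$, a vertex-monochromatic $S$-tree is a vertex-monochromatic tree in $H$ whose vertex set contains $S$. For a connected graph $G$ and an integer $k$ with $2\leq k\leq |V(G)|$, an $MVX_k$-coloring of $G$ is a vertex-coloring of $G$ such that for every set $S$ of $k$ vertices of $G$ there exists a vertex-monochromatic $S$-tree. The $k$-monochromatic vertex-index $mvx_k(G)$ is the maximum number of colors used in an $MVX_k$-coloring of $G$. A bound is called sharp if for each pair $(n,k)$ in the stated range there is a graph $G$ on $n$ vertices, with $G$ and $\overline{G}$ connected, attaining equality. *)

(* Defs.v *)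
From mathcomp Require Import all_boot.

Set Implicit Arguments.
Unset Strict Implicit.
Unset Printing Implicit Defensive.

Record sgraph := SGraph {
  vertex :> finType;
  adj : rel vertex;
  adj_sym : symmetric adj;
  adj_irrefl : irreflexive adj
}.

Section Graphs.
Variable G : sgraph.

Definition connected_graph : bool :=
  (0 < #|G|) && [forall x : G, forall y : G, connect (@adj G) x y].

Definition cadj : rel G := [rel x y | (x != y) && ~~ adj x y].

Lemma cadj_sym : symmetric cadj.
Proof. by move=> x y; rewrite /cadj /= eq_sym adj_sym. Qed.

Lemma cadj_irrefl : irreflexive cadj.
Proof. by move=> x; rewrite /cadj /= eqxx. Qed.

Definition compl : sgraph := SGraph cadj_sym cadj_irrefl.

(* An edge is the two-element set of its endpoints. *)
Definition edges : {set {set G}} :=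
  [set E | [exists x : G, exists y : G, adj x y && (E == [set x; y])]].

Implicit Types (A S : {set G}) (F : {set {set G}}).

(* A subgraph is a pair (A, F) of a vertex set and an edge set. *)
Definition subgraph A F : bool := (F \subset edges) && (cover F \subset A).

Definition sub_adj F : rel G := [rel x y | [set x; y] \in F].

Definition sub_connected A F : bool :=
  (A != set0) && [forall x in A, forall y in A, connect (sub_adj F) x y].

(* A cycle is a duplicate-free closed walk of length at least 3; having no
   repeated vertex, it has at most #|G| vertices, so the range of m loses
   nothing. *)
Definition acyclic F : bool :=
  [forall m : 'I_#|G|.+1, forall p : m.-tuple G,
    ucycleb (sub_adj F) p ==> (m < 3)].

Definition subtree A F : bool :=
  [&& subgraph A F, sub_connected A F & acyclic F].

Definition sub_degree F (x : G) : nat := #|[set E in F | x \in E]|.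

Definition leaf F (x : G) : bool := sub_degree F x == 1.

Definition internal A F (x : G) : bool := (x \in A) && ~~ leaf F x.

Section Colorings.
Variables (C : finType) (c : G -> C).

Definition vertex_mono_tree A F : bool :=
  subtree A F &&
  [forall x : G, forall y : G, internal A F x && internal A F y ==> (c x == c y)].

Definition vertex_mono_Stree S A F : bool :=
  vertex_mono_tree A F && (S \subset A).

Definition MVX_coloring (k : nat) : bool :=
  [forall S : {set G}, (#|S| == k) ==>
    [exists A : {set G}, exists F : {set {set G}}, vertex_mono_Stree S A F]].

Definition num_colors : nat := #|[set c x | x : G]|.

End Colorings.

(* A coloring uses at most #|G| colors, so a palette of that size suffices. For
   connected G and 2 <= k <= #|G| the constant coloring is an MVX_k-coloring, so
   the maximum is then over a nonempty set. *)
Definition mvx (k : nat) : nat :=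
  \max_(c : {ffun G -> 'I_#|G|} | MVX_coloring c k) num_colors c.

End Graphs.

Definition mvx_sum_lower_bound (n k b : nat) : Prop :=
  forall G : sgraph, #|G| = n ->
    connected_graph G -> connected_graph (compl G) ->
    b <= mvx G k + mvx (compl G) k.

Definition mvx_sum_attained (n k b : nat) : Prop :=
  exists G : sgraph,
    [/\ #|G| = n, connected_graph G, connected_graph (compl G)
      & mvx G k + mvx (compl G) k = b].

Definition mvx_sum_sharp_lower_bound (n k b : nat) : Prop :=
  mvx_sum_lower_bound n k b /\ mvx_sum_attained n k b.

(* Main.v *)
Require Import Defs.
From mathcomp Require Import all_boot zify.

(** The internal vertices of a tree on at least three vertices form a connected
    set [D], and the leaves are adjacent to [D].  Conversely a connected set [D]
    has a spanning tree, to which any vertices adjacent to [D] can be attached as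
    leaves.  So a colouring is an MVX-coloring for [k >= 3] exactly when every
    [k]-set is covered by a monochromatic connected set together with its
    boundary ([covers_Stree], [Stree_covers]); trees play no role afterwards.

    Lower bounds.  A connected set [D] can be enlarged to a connected dominating
    set without its boundary losing vertices, whence
    [#|boundary D| + 1 <= mvx G k] ([mvx_boundary]).  If [G] has two vertices
    [x], [y] at distance at least 3, then [[set x; y]] dominates the complement,
    which gives it [n - 1] colours.  The graph [G] has at least 4 colours if it
    has a vertex of degree at least 3.  Otherwise it has maximum degree 2 and
    at least 3 colours, and the sum [n + 3] is still reached when [G] has no
    total dominating set of size [k], because then the complement can be given
    [n] distinct colours.  Counting shows that a total dominating set in a graph
    of maximum degree 2 has at least [n / 2] vertices, and that its size is even
    in case of equality; this explains the dependence on [n] modulo 4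
    ([mvx_sum_lower_far]).  If both graphs have diameter 2, single vertices and closed
    neighbourhoods as [D] give enough colours unless all degrees are as close as
    possible to [(n - 1) / 2], and then for [n >= 7] an edge with a large
    boundary or a dominating path on three vertices gains what is missing
    ([mvx_near_regular], [mvx_sum_lower_diam2]).

    Sharpness.  For [n >= 7] the path is extremal: it has 3 colours, and a minimum
    total dominating set shows that its complement has no [n] colours for large
    [k].  The 5-cycle is extremal for [n = 5], and the 5-cycle with one vertex
    duplicated for [n = 6]; there a colouring with at least [n - 1] colours is
    refuted by a finite check, as at most two vertices share a colour. *)

Set Implicit Arguments.
Unset Strict Implicit.
Unset Printing Implicit Defensive.

(** * Connected sets and their boundaries *)

Section ConnectedSets.
Variable G : sgraph.
Implicit Types (D X A S : {set G}) (F : {set {set G}}) (x y z : G).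

(** Vertex sets inducing a connected subgraph, generated one neighbour at a
    time: this is the order in which a spanning tree of the set is built, so the
    tree comes by induction on the derivation. *)
Inductive conn : {set G} -> Prop :=
| conn_set1 x : conn [set x]
| conn_setU1 D x y : conn D -> x \in D -> adj x y -> conn (y |: D).

Definition nbrs x : {set G} := [set y | adj x y].

Definition boundary D : {set G} :=
  [set y | (y \notin D) && [exists x in D, adj x y]].

Lemma boundaryP D y :
  reflect (y \notin D /\ exists2 x, x \in D & adj x y) (y \in boundary D).
Proof.
rewrite inE; apply: (iffP andP) => [[yD /exists_inP]|[yD /exists_inP]] //.
Qed.

Lemma in_boundary D x y : x \in D -> adj x y -> y \notin D -> y \in boundary D.
Proof. by move=> xD xy yD; apply/boundaryP; split=> //; exists x. Qed.

Lemma conn_neq0 D : conn D -> D != set0.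
Proof.
case=> [x|{}D x y _ _ _]; first by apply/set0Pn; exists x; rewrite set11.
by apply/set0Pn; exists y; rewrite setU11.
Qed.

Lemma conn_set2 x y : adj x y -> conn [set x; y].
Proof.
by move=> xy; rewrite setUC; apply: conn_setU1 xy; rewrite ?set11 //; constructor.
Qed.

Lemma path_exit (e : rel G) X x p :
  path e x p -> x \in X -> last x p \notin X ->
  exists a b, [/\ a \in X, b \notin X, b \in p & e a b].
Proof.
elim: p x => [|y p IHp] x /=; first by move=> _ ->.
case/andP=> exy ep xX lX; case: (boolP (y \in X)) => yX; last first.
  by exists x, y; rewrite mem_head.
by have [a [b [? ? bp ?]]] := IHp y ep yX lX; exists a, b; rewrite inE bp orbT.
Qed.

Lemma connected_exit X x y :
  connected_graph G -> x \in X -> y \notin X -> exists z, z \in boundary X.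
Proof.
case/andP=> _ /forallP/(_ x)/forallP/(_ y)/connectP[p exp ->] xX lX.
have [a [b [aX bX _ ab]]] := path_exit exp xX lX.
by exists b; apply: in_boundary ab bX.
Qed.

(** Absorb vertices of [X] one by one: as long as a vertex of [X] is missing
    from the set reached so far, a path to it leaves that set inside [X]. *)
Lemma conn_of_paths X x0 : x0 \in X ->
  {in X, forall y, exists2 p, path (@adj G) x0 p & last x0 p = y /\ {subset p <= X}} ->
  conn X.
Proof.
move=> x0X pathX.
suff grow m D : conn D -> x0 \in D -> D \subset X -> #|X :\: D| <= m -> conn X.
  apply: (grow _ _ (conn_set1 x0)); rewrite ?set11 ?sub1set //.
elim: m D => [|m IHm] D cD x0D DX.
  rewrite leqn0 cards_eq0 setD_eq0 => XD.
  by have -> : X = D by apply/eqP; rewrite eqEsubset XD.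
move=> szX; case: (boolP (X \subset D)) => [XD|].
  by have -> : X = D by apply/eqP; rewrite eqEsubset XD.
case/subsetPn=> y yX yD; have [p ep [lp pX]] := pathX y yX.
have [|a [b [aD bD /pX bX ab]]] := path_exit ep x0D; first by rewrite lp.
apply: (IHm (b |: D)) (conn_setU1 cD aD ab) _ _ _.
- by rewrite inE x0D orbT.
- by rewrite subUset sub1set bX.
rewrite -ltnS; apply: leq_trans szX; apply: proper_card.
rewrite properE setDS ?subsetUr //=; apply/subsetPn.
by exists b; rewrite !inE ?bX ?bD ?eqxx.
Qed.

(** * Growing subtrees *)

Lemma acyclicP F :
  reflect (forall p : seq G, ucycle (sub_adj F) p -> size p < 3) (acyclic F).
Proof.
apply: (iffP forallP) => [acF p ucp | acF m].
  have szp : size p < #|G|.+1.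
    by case/andP: ucp => _ up; rewrite ltnS -(card_uniqP up) max_card.
  by move/(_ (Ordinal szp))/forallP/(_ (in_tuple p))/implyP: acF; apply.
apply/forallP=> p; apply/implyP=> ucp.
by have := acF p ucp; rewrite size_tuple.
Qed.

Lemma sub_adj_sym F : symmetric (sub_adj F).
Proof. by move=> x y; rewrite /sub_adj /= setUC. Qed.

Lemma edge_set2 x y : ([set x; y] \in edges G) = adj x y.
Proof.
rewrite inE; apply/existsP/idP => [[a /existsP[b /andP[ab /eqP E]]]|xy]; last first.
  by exists x; apply/existsP; exists y; rewrite xy eqxx.
have nab : a != b by apply: contraTneq ab => ->; rewrite adj_irrefl.
have ax : a \in [set x; y] by rewrite E set21.
have bx : b \in [set x; y] by rewrite E set22.
move: ax bx nab; rewrite !inE => /orP[]/eqP ax /orP[]/eqP bx.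
- by rewrite ax bx eqxx.
- by rewrite -ax -bx.
- by rewrite adj_sym -ax -bx.
by rewrite ax bx eqxx.
Qed.

Lemma subtree_set1 x : subtree [set x] set0.
Proof.
apply/and3P; split.
- by rewrite /subgraph sub0set /cover big_set0 sub0set.
- rewrite /sub_connected; apply/andP; split.
    by apply/set0Pn; exists x; rewrite set11.
  by apply/forall_inP=> y /set1P->; apply/forall_inP=> z /set1P->; rewrite connect0.
apply/acyclicP=> [[|a [|b p]]] //= /andP[/=].
by rewrite /sub_adj /= in_set0.
Qed.

(** No cycle is created: on a cycle through [x] of length at least 3 both
    neighbours of [x] would have to be [a]. *)
Lemma subtree_pendant A F a x :
  subtree A F -> a \in A -> adj a x -> x \notin A ->
  subtree (x |: A) ([set a; x] |: F).
Proof.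
move=> /and3P[/andP[Fe cF] /andP[_ cA] acF] aA ax xA.
have xF E : E \in F -> x \notin E.
  move=> EF; apply: contra xA => xE; apply: (subsetP cF).
  by apply/bigcupP; exists E.
have onlya z : sub_adj ([set a; x] |: F) x z -> z = a.
  rewrite /sub_adj /= in_setU1 => /orP[/eqP E|/xF]; last by rewrite set21.
  have : a \in [set x; z] by rewrite E set21.
  rewrite !inE => /orP[/eqP ea|/eqP->//]; by rewrite ea (negbTE xA) in aA.
apply/and3P; split.
- apply/andP; split.
    by rewrite subUset sub1set edge_set2 ax.
  apply/bigcupsP=> E; rewrite in_setU1 => /orP[/eqP->|EF].
    by rewrite subUset !sub1set !inE aA eqxx orbT.
  by apply: subset_trans (subsetUr _ _); apply: subset_trans cF; apply: bigcup_sup.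
- apply/andP; split; first by apply/set0Pn; exists x; rewrite setU11.
  have csym := sym_connect_sym (sub_adj_sym ([set a; x] |: F)).
  have toa y : y \in x |: A -> connect (sub_adj ([set a; x] |: F)) y a.
    rewrite in_setU1 => /orP[/eqP->|yA].
      by apply: connect1; rewrite /sub_adj /= setUC setU11.
    have := forall_inP (forall_inP cA y yA) a aA.
    apply: connect_sub => u v uv; apply: connect1.
    by rewrite /sub_adj /= in_setU1 [_ \in F]uv orbT.
  apply/forall_inP=> y yA; apply/forall_inP=> z zA.
  by apply: connect_trans (toa y yA) _; rewrite csym toa.
apply/acyclicP=> p /andP[cp up]; case: (boolP (x \in p)) => xp; last first.
  apply: (acyclicP _ acF); rewrite /ucycle up andbT.
  apply: sub_in_cycle (allss p) cp => u v up' vp'.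
  rewrite /sub_adj /= in_setU1 => /orP[/eqP E|//].
  have : x \in [set u; v] by rewrite E set22.
  by rewrite !inE => /orP[]/eqP E'; rewrite -E' (negbTE xp) in up' vp'.
rewrite ltnNge; apply/negP; case/rot_to: xp => i q Eq; rewrite -(size_rot i) Eq.
move: cp up; rewrite -(rot_cycle i) -(rot_uniq i) Eq.
case: q {Eq} => [|b q] //=; case/lastP: q => [|q c] //=.
rewrite rcons_path last_rcons (sub_adj_sym _ c) => /and3P[/onlya-> _ /onlya->].
by rewrite mem_rcons mem_head andbF.
Qed.

Lemma leaf_pendant A F a x :
  subtree A F -> x \notin A -> leaf ([set a; x] |: F) x.
Proof.
move=> /and3P[/andP[_ cF] _ _] xA; rewrite /leaf /sub_degree.
rewrite (_ : [set E in _ | _] = [set [set a; x]]) ?cards1 //.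
apply/setP=> E; rewrite !inE; case: eqP => [->|_] /=; first by rewrite set22.
apply/negbTE; apply: contra xA => /andP[EF xE]; apply: (subsetP cF).
by apply/bigcupP; exists E.
Qed.

Lemma leaf_pendant_other F a x z :
  z != a -> z != x -> leaf ([set a; x] |: F) z = leaf F z.
Proof.
move=> za zx; rewrite /leaf /sub_degree; congr (#|pred_of_set _| == 1).
apply/setP=> E; rewrite !inE; case: eqP => [->|_] //=.
by rewrite !inE (negbTE za) (negbTE zx) andbF.
Qed.

Lemma conn_subtree D : conn D -> exists F, subtree D F.
Proof.
elim=> [x|{}D x y _ [F tF] xD xy]; first by exists set0; apply: subtree_set1.
case: (boolP (y \in D)) => yD.
  by exists F; rewrite (setUidPr _) ?sub1set.
by exists ([set x; y] |: F); apply: subtree_pendant.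
Qed.

(** A subtree spanning [D] extended by pendant edges to the vertices of [S]:
    its internal vertices all lie in [D], so only the colours on [D] have to
    agree. *)
Lemma conn_spider D S : conn D -> S \subset boundary D ->
  exists F, subtree (S :|: D) F /\ {in S, forall x, leaf F x}.
Proof.
move=> cD; elim: {S}#|S| {-2}S (erefl #|S|) => [|m IHm] S.
  move/eqP; rewrite cards_eq0 => /eqP-> _; rewrite set0U.
  have [F tF] := conn_subtree cD; exists F; split=> // x; by rewrite inE.
move=> cS SB; have [x xS] : exists x, x \in S by apply/card_gt0P; rewrite cS.
have [] := IHm (S :\ x); first by move: cS; rewrite (cardsD1 x) xS; lia.
  by apply: subset_trans SB; apply: subsetDl.
move=> F [tF lF]; have /boundaryP[xD [a aD ax]] := subsetP SB x xS.
have xn : x \notin S :\ x :|: D by rewrite !inE eqxx.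
have an : a \in S :\ x :|: D by rewrite inE aD orbT.
exists ([set a; x] |: F); split.
  by rewrite -(setD1K xS) -setUA; apply: subtree_pendant.
move=> z zS; case: (eqVneq z x) => [->|zx]; first by apply: leaf_pendant tF xn.
rewrite leaf_pendant_other //; first by apply: lF; rewrite !inE zx.
apply: contraTneq aD => <-; by case/boundaryP: (subsetP SB z zS).
Qed.

(** * Vertex-monochromatic trees as monochromatic connected sets *)

(** What remains of a vertex-monochromatic tree containing [S] when the tree
    structure is forgotten: [D] plays the role of its internal vertices, and
    [Stree_covers] and [covers_Stree] translate back and forth. *)
Definition covers (C : finType) (c : G -> C) S : Prop :=
  exists D, [/\ conn D, {in D &, forall x y, c x = c y}
              & S \subset D :|: boundary D].

Lemma covers_Stree (C : finType) (c : G -> C) S :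
  covers c S -> exists A F, vertex_mono_Stree c S A F.
Proof.
case=> D [cD mD SD].
have SB : S :\: D \subset boundary D by rewrite subDset.
have [F [tF lF]] := conn_spider cD SB.
exists (S :\: D :|: D), F; apply/andP; split; last first.
  by apply/subsetP=> x xS; rewrite !inE xS; case: (x \in D).
rewrite /vertex_mono_tree tF /=.
have int x : internal (S :\: D :|: D) F x -> x \in D.
  rewrite /internal in_setU => /andP[/orP[/lF->//|]//].
apply/forallP=> x; apply/forallP=> y; apply/implyP=> /andP[/int xD /int yD].
by apply/eqP; apply: mD.
Qed.

Lemma degree_gt1 F x y z :
  y != z -> sub_adj F y x -> sub_adj F x z -> ~~ leaf F x.
Proof.
move=> yz yx xz; rewrite /leaf /sub_degree neq_ltn; apply/orP; right.
have ne : [set y; x] != [set x; z].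
  apply/eqP=> E; have : y \in [set x; z] by rewrite -E set21.
  have : z \in [set y; x] by rewrite E set22.
  rewrite !inE eq_sym (negbTE yz) /= => /eqP zx; by rewrite -zx (negbTE yz).
apply: leq_trans (_ : #|[set [set y; x]; [set x; z]]| <= _).
  by rewrite cards2 ne.
apply/subset_leq_card/subsetP=> E; rewrite !inE => /orP[]/eqP->.
  by rewrite [_ \in F]yx !inE eqxx orbT.
by rewrite [_ \in F]xz !inE eqxx.
Qed.
(** Along a simple path every vertex but the two ends has a predecessor and a
    different successor. *)
Lemma path_nonleaf F x p :
  path (sub_adj F) x p -> uniq (x :: p) -> {in p, forall y, y != last x p -> ~~ leaf F y}.
Proof.
elim: p x => [|y p IHp] x //= /andP[xy ep] /and3P[xp yp up] z.
rewrite inE => /orP[/eqP->|zp]; last by apply: (IHp y) => //=; rewrite yp.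
case: p {IHp} ep xp yp up => [|w p] /=; first by rewrite eqxx.
case/andP=> yw _ xp _ _ _; apply: degree_gt1 xy yw.
by apply: contraNneq xp => ->; rewrite !inE eqxx orbT.
Qed.

(** The internal vertices of the tree form the connected set: simple paths
    between them run through internal vertices only.  Three vertices are needed
    so that the neighbour of a leaf is internal; a single edge has two leaves and
    no internal vertex. *)
Lemma Stree_covers (C : finType) (c : G -> C) S A F :
  2 < #|S| -> vertex_mono_Stree c S A F -> covers c S.
Proof.
move=> S3 /andP[/andP[/and3P[/andP[Fe cF] /andP[_ /forall_inP cA] _] mA] SA].
have memA x y : sub_adj F x y -> x \in A.
  move=> xy; apply: (subsetP cF); apply/bigcupP; exists [set x; y] => //.
  by rewrite set21.
have eadj x y : sub_adj F x y -> adj x y.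
  by move=> xy; rewrite -edge_set2; apply: (subsetP Fe).
pose D := [set x | internal A F x].
have spath x y : x \in A -> y \in A -> exists p,
    [/\ path (sub_adj F) x p, uniq (x :: p) & last x p = y].
  move=> xA yA; have /connectP[p ep ->] := forall_inP (cA x xA) y yA.
  by case/shortenP: ep => q eq uq _; exists q.
have inA x p : path (sub_adj F) x p -> {subset p <= A}.
  elim: p x => [|y p IHp] x //= /andP[xy ep] z.
  rewrite inE => /orP[/eqP->|]; last by apply: IHp ep _.
  by apply: (@memA _ x); rewrite sub_adj_sym.
(* The neighbour [t] of the leaf [x] has degree at least 2, because a path
   from [x] to a third vertex [z] has to start with [t] and to go on. *)
have lnb x : x \in A -> x \notin D -> x \in boundary D.
  move=> xA xD; have xl : leaf F x.
    by move: xD; rewrite inE /internal xA negbK.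
  have A3 : 2 < #|A| by apply: leq_trans S3 (subset_leq_card SA).
  have [y yA yx] : exists2 y, y \in A & y != x.
    have : 0 < #|A :\ x| by move: A3; rewrite (cardsD1 x) xA; lia.
    by case/card_gt0P=> y; rewrite !inE => /andP[? ?]; exists y.
  have [p [ep up lp]] := spath x y xA yA.
  case: p ep up lp => [|t p] /=; first by move=> _ _ E; rewrite E eqxx in yx.
  case/andP=> xt _ _ _.
  have tA : t \in A by apply: (@memA _ x); rewrite sub_adj_sym.
  apply: (@in_boundary _ t) => //; last by rewrite adj_sym; apply: eadj.
  rewrite inE /internal tA /=.
  have [z [zA zx zt]] : exists z, [/\ z \in A, z != x & z != t].
    have : 0 < #|A :\: [set x; t]|.
      have := cardsID [set x; t] A; have := cards2 x t.
      have := subset_leq_card (subsetIr A [set x; t]); lia.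
    case/card_gt0P=> z; rewrite !inE negb_or => /andP[/andP[? ?] ?]; by exists z.
  have [q [eq uq lq]] := spath x z xA zA.
  case: q eq uq lq => [|t' q] /=; first by move=> _ _ E; rewrite E eqxx in zx.
  case/andP=> xt' eq uq lq.
  have [Ett|ntt] := eqVneq t' t; last first.
    have tx : sub_adj F t x by rewrite sub_adj_sym.
    have : ~~ leaf F x by apply: degree_gt1 tx xt'; rewrite eq_sym.
    by rewrite xl.
  subst t'; apply: (@path_nonleaf F x (t :: q)); rewrite //= ?xt ?mem_head //.
  by rewrite lq eq_sym.
have conD : conn D.
  have [x0 x0D] : exists x, x \in D.
    have [x xA] : exists x, x \in A.
      by apply/card_gt0P; move: (subset_leq_card SA); lia.
    case: (boolP (x \in D)) => xD; first by exists x.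
    by have /boundaryP[_ [y yD _]] := lnb x xA xD; exists y.
  apply: (conn_of_paths x0D) => y yD.
  have xA : x0 \in A by move: x0D; rewrite inE => /andP[].
  have yA : y \in A by move: yD; rewrite inE => /andP[].
  have [p [ep up lp]] := spath x0 y xA yA; exists p.
    by apply: sub_path ep => u v; apply: eadj.
  split=> // z zp; case: (eqVneq z y) => [->//|zy].
  by rewrite inE /internal (inA _ _ ep) //= (path_nonleaf ep up) ?lp.
exists D; split=> //.
- move=> x y; rewrite !inE => ix iy; apply/eqP.
  by move/forallP/(_ x)/forallP/(_ y)/implyP: mA; rewrite ix iy; apply.
apply/subsetP=> x /(subsetP SA) xA; rewrite inE.
by case: (boolP (x \in D)) => //= /lnb->.
Qed.

End ConnectedSets.

(** * Bounds on the monochromatic vertex-index *)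

Section Mvx.
Variable G : sgraph.
Implicit Types (D X A S : {set G}) (x y z : G).

Lemma mvx_geq k (c : {ffun G -> 'I_#|G|}) :
  (forall S, #|S| = k -> covers c S) -> num_colors c <= mvx G k.
Proof.
move=> cov; apply: leq_bigmax_cond.
apply/forallP=> S; apply/implyP=> /eqP/cov/covers_Stree[A [F T]].
by apply/existsP; exists A; apply/existsP; exists F.
Qed.

Lemma superset_card (T : finType) (S : {set T}) k :
  #|S| <= k <= #|T| -> exists2 S' : {set T}, S \subset S' & #|S'| = k.
Proof.
move/andP=> [Sk kT]; elim: k Sk kT => [|k IHk] Sk kT.
  by exists S => //; apply/eqP; rewrite -leqn0.
case: (eqVneq #|S| k.+1) => [<-|ne]; first by exists S.
have [|| S' SS' cS'] := IHk; [lia | lia |].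
have [x xS'] : exists x : T, x \in ~: S'.
  by apply/card_gt0P; have := cardsC S'; lia.
exists (x |: S'); first by apply: subset_trans (subsetUr _ _).
by rewrite cardsU1 cS'; rewrite inE in xS'; rewrite xS'.
Qed.

(** Sets of fewer than [k] vertices are covered too, since they extend to sets
    of exactly [k] vertices; upper bounds can therefore be tested on small sets. *)
Lemma mvx_leq k b : 2 < k <= #|G| ->
  (forall c : G -> 'I_#|G|, (forall S, #|S| <= k -> covers c S) -> num_colors c <= b) ->
  mvx G k <= b.
Proof.
move=> /andP[k3 kG] bnd; apply/bigmax_leqP => c /forallP mvc; apply: bnd => S Sk.
have [|S' SS' cS'] := @superset_card _ S k; first by rewrite Sk.
have /existsP[A /existsP[F T]] := implyP (mvc S') (introT eqP cS').
have [|D [cD mD SD]] := Stree_covers _ T; first by rewrite cS'.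
by exists D; split=> //; apply: subset_trans SD.
Qed.

(** A connected dominating set [D] receives one colour and every other vertex
    its own colour. *)
Lemma mvx_cds k D : conn D -> D :|: boundary D = setT -> #|~: D|.+1 <= mvx G k.
Proof.
move=> cD domD; have /set0Pn[d dD] := conn_neq0 cD.
pose c := [ffun x => enum_rank (if x \in D then d else x)].
apply: leq_trans (@mvx_geq k c _) => [|S _]; last first.
  exists D; split=> // [x y xD yD|]; last by rewrite domD subsetT.
  by rewrite !ffunE xD yD.
rewrite /num_colors -[X in X <= _](_ : #|[set enum_rank x | x in d |: ~: D]| = _).
  apply/subset_leq_card/subsetP=> _ /imsetP[x xD ->]; apply/imsetP.
  exists x => //; rewrite ffunE; case: ifP => // xD'.
  by move: xD; rewrite !inE xD' orbF => /eqP->.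
by rewrite card_imset ?cardsU1 ?inE ?dD //; apply: enum_rank_inj.
Qed.

(** Absorb into [D] a boundary vertex that has a neighbour outside [D] and its
    boundary: the boundary loses one vertex and gains at least one. *)
Lemma grow_boundary D : connected_graph G -> conn D ->
  exists D', [/\ conn D', D' :|: boundary D' = setT & #|boundary D| <= #|boundary D'|].
Proof.
move=> cG; move: {2}#|_| (leqnn #|~: (D :|: boundary D)|) => m.
elim: m D => [|m IHm] D sz cD.
  exists D; split=> //; move: sz; rewrite leqn0 cards_eq0 => /eqP E.
  by rewrite -[LHS]setCK E setC0.
case: (set_0Vmem (~: (D :|: boundary D))) => [E|[y yD]].
  by exists D; split=> //; rewrite -[LHS]setCK E setC0.
have /set0Pn[d dD] := conn_neq0 cD.
have [||z /boundaryP[zB [x xB xz]]] :=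
  connected_exit (X := D :|: boundary D) (x := d) (y := y) cG.
- by rewrite inE dD.
- by rewrite inE in yD.
move: zB; rewrite inE negb_or => /andP[zD zB].
have xbD : x \in boundary D.
  move: xB; rewrite inE => /orP[xD|//].
  by rewrite (in_boundary xD xz zD) in zB.
have /boundaryP[xD [a aD ax]] := xbD.
have zB' : z \in boundary (x |: D).
  apply: (in_boundary (setU11 x D) xz); rewrite !inE negb_or zD andbT.
  by apply: contraNneq zB => ->.
have bsub : boundary D :\ x \subset boundary (x |: D).
  apply/subsetP=> u; rewrite in_setD1 => /andP[ux /boundaryP[uD [w wD wu]]].
  apply: (@in_boundary _ _ w) => //; first by rewrite inE wD orbT.
  by rewrite !inE negb_or ux uD.
have [||D' [cD' dom le]] := IHm (x |: D).
- rewrite -ltnS; apply: leq_trans sz; apply: proper_card.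
  rewrite properE; apply/andP; split; last first.
    apply/subsetPn; exists z; first by rewrite inE in_setU negb_or zD zB.
    by rewrite inE negbK in_setU zB' orbT.
  rewrite setCS subUset; apply/andP; split.
    by apply/subsetP=> u uD; rewrite !in_setU uD orbT.
  apply/subsetP=> u uB; case: (eqVneq u x) => [->|ux]; first by rewrite in_setU setU11.
  by rewrite in_setU (subsetP bsub) ?orbT // in_setD1 ux.
- by apply: conn_setU1 ax.
exists D'; split=> //; apply: leq_trans le.
rewrite (cardsD1 x) xbD add1n.
have -> : (#|boundary D :\ x|).+1 = #|z |: boundary D :\ x|.
  by rewrite cardsU1 in_setD1 (negbTE zB) andbF.
by apply/subset_leq_card; rewrite subUset sub1set zB'.
Qed.

(** The main source of lower bounds: the vertices adjacent to a connected set,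
    like the leaves of a partial tree, remain as numerous when that set is
    suitably grown into a connected dominating set. *)
Lemma mvx_boundary k D : connected_graph G -> conn D -> #|boundary D|.+1 <= mvx G k.
Proof.
move=> cG /(grow_boundary cG)[D' [cD' dom le]].
apply: leq_trans (mvx_cds k cD' dom); rewrite ltnS; apply: leq_trans le _.
by apply/subset_leq_card/subsetP=> x /boundaryP[]; rewrite inE.
Qed.

Definition deg x := #|nbrs x|.

Lemma boundary_set1 x : boundary [set x] = nbrs x.
Proof.
apply/setP=> y; rewrite [RHS]inE; apply/boundaryP/idP => [[_ [z /set1P->]] //|xy].
split; last by exists x; rewrite ?set11.
by apply: contraTN xy => /set1P->; rewrite adj_irrefl.
Qed.

Lemma mvx_deg k x : connected_graph G -> (deg x).+1 <= mvx G k.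
Proof. by move=> cG; rewrite /deg -boundary_set1 mvx_boundary //; constructor. Qed.

Definition total_dominating S := forall x, exists2 y, y \in S & adj x y.

(** When all colours differ the monochromatic trees are the stars, and stars
    suffice under this hypothesis. *)
Lemma mvx_all k :
  (forall S, #|S| = k -> exists v : G, S \subset v |: nbrs v) -> #|G| <= mvx G k.
Proof.
move=> st; apply: leq_trans (@mvx_geq k [ffun x => enum_rank x] _) => [|S /st[v Sv]].
  rewrite /num_colors (eq_imset _ (ffunE _)) card_imset ?cardsT //.
  exact: enum_rank_inj.
exists [set v]; split; [constructor| | by rewrite boundary_set1].
by move=> x y /set1P-> /set1P->.
Qed.

(** If [c a = c b] with [a != b], then [c] is injective off [a] and off [b] by
    counting, so every other collision must involve both of them. *)
Lemma almost_injective (C : finType) (c : G -> C) (g0 : G) :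
  #|G|.-1 <= num_colors c -> exists a b, forall x y, x != y -> c x = c y ->
    [set x; y] = [set a; b].
Proof.
move=> nc; case: (boolP (injectiveb c)) => [/injectiveP ci|].
  by exists g0, g0 => x y xy /ci E; rewrite E eqxx in xy.
case/injectivePn=> a [b ab cab]; exists a, b.
have inj_without u v : u != v -> c u = c v -> {in [set~ v] &, injective c}.
  move=> uv cuv; apply/imset_injP; rewrite eqn_leq leq_imset_card /=.
  rewrite cardsC1; apply: leq_trans nc _; rewrite /num_colors.
  apply/subset_leq_card/subsetP=> _ /imsetP[x _ ->]; apply/imsetP.
  case: (eqVneq x v) => [->|xv]; first by exists u; rewrite // !inE.
  by exists x; rewrite // !inE.
have hit u v x y : u != v -> c u = c v -> x != y -> c x = c y -> v \in [set x; y].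
  move=> uv cuv xy cxy; apply: contraNT xy => vxy; apply/eqP.
  move: vxy; rewrite !inE negb_or => /andP[vx vy].
  by apply: (inj_without _ _ uv cuv); rewrite // !inE eq_sym.
move=> x y xy cxy; apply/esym/eqP; rewrite eqEcard !cards2 ab xy andbT.
by rewrite subUset !sub1set (hit a b) // (hit b a) // eq_sym.
Qed.

Lemma mono_small (C : finType) (c : G -> C) (g0 : G) :
  #|G|.-1 <= num_colors c -> exists a b, forall D, D != set0 ->
    {in D &, forall x y, c x = c y} -> (exists x, D = [set x]) \/ D = [set a; b].
Proof.
move=> /(almost_injective g0)[a [b ab]]; exists a, b => D /set0Pn[x xD] mD.
case: (boolP (D \subset [set x])) => [Dx|/subsetPn[y yD]].
  by left; exists x; apply/eqP; rewrite eqEsubset Dx sub1set.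
rewrite inE eq_sym => xy; right; rewrite -(ab x y xy (mD x y xD yD)).
apply/eqP; rewrite eqEsubset subUset !sub1set xD yD !andbT.
apply/subsetP=> z zD; rewrite !inE; case: (eqVneq z x) => //= zx; case: (eqVneq z y) => //= zy.
have E1 := ab x y xy (mD x y xD yD).
have : z \in [set z; x] by rewrite !inE eqxx.
by rewrite (ab z x zx (mD z x zD xD)) -E1 !inE (negbTE zx) (negbTE zy).
Qed.

End Mvx.

(** * Complements, total domination, and distance at least 3 *)

(** [compl (compl G)] is not the record [G], but it has the same edges and hence
    the same invariants; the lower bound is symmetric in a graph and its
    complement through the next lemmas. *)
Lemma adj_cadj_cadj (G : sgraph) (x y : G) : @cadj (compl G) x y = adj x y.
Proof.
rewrite /cadj /= negb_and !negbK; case: (x =P y) => [->|] //=.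
by rewrite adj_irrefl.
Qed.

Lemma edges_compl_compl (G : sgraph) : edges (compl (compl G)) = edges G.
Proof.
apply/setP=> E; rewrite !inE; apply: eq_existsb => x; apply: eq_existsb => y.
by rewrite /= adj_cadj_cadj.
Qed.

Lemma mvx_compl_compl (G : sgraph) k : mvx (compl (compl G)) k = mvx G k.
Proof.
apply: eq_bigl => c; apply: eq_forallb => S; congr (_ ==> _).
apply: eq_existsb => A; apply: eq_existsb => F.
rewrite /vertex_mono_Stree /vertex_mono_tree /subtree /subgraph.
by rewrite edges_compl_compl.
Qed.

Lemma connected_compl_compl (G : sgraph) :
  connected_graph (compl (compl G)) = connected_graph G.
Proof.
congr (_ && _); apply: eq_forallb => x; apply: eq_forallb => y.
apply: eq_connect => u v /=.
exact: adj_cadj_cadj.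
Qed.

(** For [4 <= n] this says that [k] is smaller than the total domination number
    of the path on [n] vertices (see [total_dominating_card] and
    [card_path_tds]); it separates the range of [k] where the bound is [n + 3]
    from the range where it is [n + 2]. *)
Definition below_total n k := (2 * k < n) || (2 * k == n) && odd k.

Section LowerBounds.
Variable G : sgraph.
Implicit Types (D X A B S : {set G}) (x y z u v w : G).

Lemma card_nbrsI x B : #|nbrs x :&: B| = \sum_(y in B) adj x y.
Proof.
rewrite -sum1_card big_mkcond [RHS]big_mkcond; apply: eq_bigr => y _.
by rewrite !inE; case: (y \in B); rewrite ?andbF ?andbT //; case: adj.
Qed.

Lemma double_counting A B :
  \sum_(x in A) #|nbrs x :&: B| = \sum_(y in B) #|nbrs y :&: A|.
Proof.
under eq_bigr do rewrite card_nbrsI.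
under [RHS]eq_bigr do rewrite card_nbrsI.
by rewrite exchange_big; apply: eq_bigr => y _; apply: eq_bigr => x _; rewrite adj_sym.
Qed.

(** Each edge inside [S] is counted from both ends. *)
Lemma handshake S : ~~ odd (\sum_(x in S) #|nbrs x :&: S|).
Proof.
elim: {S}#|S| {-2}S (erefl #|S|) => [|m IHm] S cS.
  by move/eqP: cS; rewrite cards_eq0 => /eqP->; rewrite big_set0.
have [s sS] : exists x, x \in S by apply/card_gt0P; rewrite cS.
have cS' : #|S :\ s| = m by move: cS; rewrite (cardsD1 s) sS; lia.
have split1 x : #|nbrs x :&: S| = adj x s + #|nbrs x :&: (S :\ s)|.
  by rewrite !card_nbrsI (big_setD1 s).
rewrite (big_setD1 s) //=; under eq_bigr do rewrite split1.
rewrite big_split /= split1 adj_irrefl add0n addnA oddD (negbTE (IHm _ cS')) addbF.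
rewrite card_nbrsI; under [X in _ + X]eq_bigr do rewrite adj_sym.
by rewrite addnn odd_double.
Qed.

(** Every vertex has a neighbour in [S], and each member of [S] is a neighbour of
    at most two vertices, whence [#|G| <= 2 * #|S|].  In the case of equality
    every vertex has exactly one neighbour in [S], so the edges inside [S] match
    its members in pairs. *)
Lemma total_dominating_card S : (forall x, deg x <= 2) -> total_dominating S ->
  #|G| <= 2 * #|S| /\ (#|G| = 2 * #|S| -> ~~ odd #|S|).
Proof.
move=> d2 tdS.
have ge1 x : 1 <= #|nbrs x :&: S|.
  by have [y yS xy] := tdS x; apply/card_gt0P; exists y; rewrite !inE xy.
have sumle : \sum_(x : G) #|nbrs x :&: S| <= 2 * #|S|.
  rewrite (eq_bigl (fun x => x \in setT)) => [|x]; last by rewrite inE.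
  rewrite double_counting mulnC -sum_nat_const; apply: leq_sum => x _.
  by rewrite setIT d2.
have le1 : #|G| <= \sum_(x : G) #|nbrs x :&: S|.
  by rewrite -sum1_card; apply: leq_sum.
split=> [|eqn]; first exact: leq_trans sumle.
have eq1 x : #|nbrs x :&: S| = 1.
  apply/eqP; rewrite eqn_leq ge1 andbT leqNgt; apply/negP => gt1.
  suff : #|G| < \sum_(x : G) #|nbrs x :&: S| by lia.
  rewrite -sum1_card (bigD1 x) //= [X in _ < X](bigD1 x) //=.
  by rewrite -addSn leq_add // leq_sum.
by have := handshake S; rewrite (eq_bigr (fun _ => 1)) // sum1_card.
Qed.

Lemma deg_compl x : deg (x : compl G) = #|G|.-1 - deg x.
Proof.
rewrite /deg (_ : nbrs (x : compl G) = ~: (x |: nbrs x) :> {set G}).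
  have := cardsC (x |: nbrs x); rewrite cardsU1 inE adj_irrefl /=; lia.
by apply/setP=> y; rewrite !inE negb_or eq_sym.
Qed.

Lemma deg_lt x : deg x < #|G|.
Proof.
have := cardsC (x |: nbrs x); rewrite cardsU1 inE adj_irrefl /= /deg; lia.
Qed.

(** A third vertex must be attached to some edge [xy]. *)
Lemma exists_deg_ge2 : connected_graph G -> 2 < #|G| -> exists x, 2 <= deg x.
Proof.
move=> cG n3; have /card_gt0P[x _] : 0 < #|G| by lia.
have away A : #|A| <= 2 -> exists y, y \notin A.
  move=> A2; have /card_gt0P[y] : 0 < #|~: A| by have := cardsC A; lia.
  by rewrite inE; exists y.
have [y1 Ny1] := away [set x] ltac:(by rewrite cards1).
have [y /boundaryP[yx [_ /set1P-> xy]]] := connected_exit cG (set11 x) Ny1.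
have [z1 Nz1] := away [set x; y] ltac:(by rewrite cards2; case: eqP).
have [z /boundaryP[]] := connected_exit cG (set21 x y) Nz1.
rewrite !inE negb_or => /andP[zx zy] [a axy az].
have deg2 b c : c != z -> adj b c -> adj b z -> 2 <= deg b.
  move=> cz bc bz; apply: leq_trans (_ : #|[set c; z]| <= _); first by rewrite cards2 cz.
  by apply/subset_leq_card; rewrite subUset !sub1set !inE bc bz.
case/set2P: axy az => -> az; first by exists x; apply: (deg2 _ y); rewrite // eq_sym.
by exists y; apply: (deg2 _ x); rewrite // 1?eq_sym // adj_sym.
Qed.

Definition far x y := [/\ x != y, ~~ adj x y & forall z, ~~ (adj x z && adj z y)].


(** In the complement, [x] and [y] are adjacent and together dominate all
    vertices, which gives [#|G| - 1] colours there.  The graph itself has at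
    least 4 colours if some degree exceeds 2.  Otherwise it has at least 3, and
    if no set of [k] vertices is totally dominating, then every such set has in
    the complement a vertex joined to all its other members, so that all colours
    of the complement can be different. *)
Lemma mvx_sum_lower_far k x y : connected_graph G -> connected_graph (compl G) ->
  far x y -> #|G| + 2 + below_total #|G| k <= mvx G k + mvx (compl G) k.
Proof.
move=> cG cH [xy nxy ncom].
have n3 : 2 < #|G|.
  have yx : y \notin [set x] by rewrite inE eq_sym.
  have [z /boundaryP[zx [_ /set1P-> xz]]] := connected_exit cG (set11 x) yx.
  have zy : z != y by apply: contraNneq nxy => <-.
  apply: leq_trans (max_card (z |: [set x; y])).
  by rewrite cardsU1 cards2 xy !inE negb_or zy -in_set1 zx.
have H1 : #|G|.-1 <= mvx (compl G) k.
  have := @mvx_boundary (compl G) k [set x; y] cH (conn_set2 (_ : @adj (compl G) x y)).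
  move=> /(_ ltac:(by rewrite /= /cadj /= xy)); apply: leq_trans.
  have := cardsC [set x; y]; rewrite cards2 xy => E.
  apply: leq_trans (_ : #|~: [set x; y]|.+1 <= _); first by rewrite /= in E *; lia.
  rewrite ltnS; apply/subset_leq_card/subsetP=> z; rewrite in_setC => zxy.
  have /andP[zx zy] : (z != x) && (z != y) by move: zxy; rewrite !inE negb_or.
  have adjc a : z != a -> ~~ adj a z -> @adj (compl G) a z.
    by move=> za naz; rewrite /= /cadj /= eq_sym za.
  have := ncom z; rewrite negb_and => /orP[/(adjc x zx) xz|].
    exact: (@in_boundary (compl G) [set x; y] x z (set21 x y) xz zxy).
  rewrite adj_sym => /(adjc y zy) yz.
  exact: (@in_boundary (compl G) [set x; y] y z (set22 x y) yz zxy).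
case: (boolP [exists z : G, 2 < deg z]) => [/existsP[z dz]|].
  have := mvx_deg k z cG; case: (below_total _ _); lia.
rewrite negb_exists => /forallP le2.
have d2 z : deg z <= 2 by rewrite leqNgt le2.
have [z dz] := exists_deg_ge2 cG n3; have H2 := mvx_deg k z cG.
case: (boolP (below_total #|G| k)) => [bel|_]; last by lia.
suff : #|G| <= mvx (compl G) k by lia.
apply: (@mvx_all (compl G)) => S cS.
case: (boolP [forall v : G, [exists u in (S : {set G}), @adj G v u]]) => [/forallP td|].
  have tdS : @total_dominating G S.
    by move=> v; have /exists_inP[u uS vu] := td v; exists u.
  have [le eqn] := total_dominating_card d2 tdS.
  move: bel le eqn; rewrite /below_total cS => /orP[|/andP[/eqP<- ->]]; first by lia.
  by move=> _ /(_ erefl).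
rewrite negb_forall => /existsP[v]; rewrite negb_exists_in => /forall_inP nv.
exists v; apply/subsetP=> u uS; rewrite in_setU1 [_ \in nbrs _]inE /= /cadj /=.
by rewrite (nv u uS) andbT eq_sym orbN.
Qed.

End LowerBounds.

(** * Diameter 2 and the lower bound *)

Section NearRegular.
Variable G : sgraph.
Implicit Types (D X A B S : {set G}) (x y z u v w : G).

Lemma conn_closed_nbrs x : conn (x |: nbrs x).
Proof.
apply: (@conn_of_paths _ _ x); first by rewrite setU11.
move=> y; rewrite !inE => /orP[/eqP->|xy]; first by exists [::].
exists [:: y]; rewrite /= ?xy //; split=> // z; rewrite inE => /eqP->.
by rewrite !inE xy orbT.
Qed.

(** Within distance 2 of [x], the closed neighbourhood of [x] is a connected
    dominating set. *)
Lemma mvx_codeg k x : connected_graph G ->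
  (forall y, y != x -> ~~ adj x y -> exists z, adj x z && adj z y) ->
  #|G| - deg x <= mvx G k.
Proof.
move=> cG near; apply: leq_trans (mvx_boundary k cG (conn_closed_nbrs x)).
have := cardsC (x |: nbrs x); rewrite cardsU1 inE adj_irrefl /= -/(deg x) => E.
apply: leq_trans (_ : #|~: (x |: nbrs x)|.+1 <= _); first by lia.
rewrite ltnS; apply/subset_leq_card/subsetP=> y.
rewrite in_setC => yN; have := yN; rewrite in_setU1 negb_or [y \in nbrs x]inE => /andP[yx xy].
have [z /andP[xz zy]] := near y yx xy.
by apply: in_boundary zy yN; rewrite !inE xz orbT.
Qed.

(** Let [W] be the set of vertices other than [v] not adjacent to [v].  If a
    neighbour [u] of [v] has two neighbours in [W], the edge [vu] already has
    [deg v + 1] boundary vertices.  Otherwise there are at most [deg v] edges between [nbrs v] and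
    [W], and since [deg v < 2 * #|W|] some [w] in [W] sends at most one of them;
    its degree then forces [w] to be adjacent to exactly one [u] in [nbrs v]
    and to the rest of [W], so [v], [u], [w] dominate the graph. *)
Lemma mvx_near_regular k v : connected_graph G -> 7 <= #|G| ->
  (forall x, #|G| <= 2 * deg x + 2) -> #|G| <= 2 * deg v + 1 -> 2 * deg v <= #|G| ->
  deg v + 2 <= mvx G k.
Proof.
move=> cG n7 low vlow vhigh.
pose W := ~: (v |: nbrs v).
have cardW : #|W| = #|G| - deg v - 1.
  by have := cardsC (v |: nbrs v); rewrite cardsU1 inE adj_irrefl /= -/(deg v) -/W; lia.
have NvW x : (x \in W) = (x != v) && ~~ adj v x by rewrite !inE negb_or.
have vW : v \notin W by rewrite NvW eqxx.
case: (boolP [exists u in nbrs v, 1 < #|nbrs u :&: W|]) => [/exists_inP[u]|].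
  rewrite inE => vu uW; have uv : u != v by apply: contraTneq vu => ->; rewrite adj_irrefl.
  apply: leq_trans (mvx_boundary k cG (conn_set2 vu)).
  rewrite addn2 ltnS.
  have dis : [disjoint nbrs v :\ u & nbrs u :&: W].
    rewrite -setI_eq0; apply/eqP/setP=> x; rewrite !inE negb_or.
    by case: (adj v x); rewrite ?andbF.
  apply: leq_trans (_ : #|(nbrs v :\ u) :|: (nbrs u :&: W)| <= _).
    rewrite cardsU (disjoint_setI0 dis) cards0 /deg.
    have := cardsD1 u (nbrs v); rewrite inE vu; lia.
  apply/subset_leq_card/subsetP=> x; rewrite in_setU in_setD1 in_setI NvW.
  rewrite ![x \in nbrs _]inE => /orP[/andP[xu vx]|/and3P[ux xv nvx]].
    apply: (in_boundary (set21 _ _) vx); rewrite !inE negb_or xu andbT.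
    by apply: contraTneq vx => ->; rewrite adj_irrefl.
  apply: in_boundary (set22 _ _) ux _; rewrite !inE negb_or xv /=.
  by apply: contraNneq nvx => ->.
move=> /exists_inPn small.
have [w wW wN] : exists2 w, w \in W & #|nbrs w :&: nbrs v| <= 1.
  case: (boolP [exists w in W, #|nbrs w :&: nbrs v| <= 1]) => [/exists_inP//|].
  move=> /exists_inPn big.
  suff : 2 * #|W| <= deg v by lia.
  rewrite mulnC -sum_nat_const.
  apply: leq_trans (_ : \sum_(x in W) #|nbrs x :&: nbrs v| <= _).
    by apply: leq_sum => x /big; rewrite -ltnNge.
  rewrite double_counting /deg -sum1_card; apply: leq_sum => x /small.
  by rewrite -leqNgt.
have wWsub : nbrs w :&: W \subset W :\ w.
  apply/subsetP=> x; rewrite in_setI in_setD1 => /andP[wx ->]; rewrite andbT.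
  by apply: contraTneq wx => ->; rewrite inE adj_irrefl.
have degw : deg w = #|nbrs w :&: nbrs v| + #|nbrs w :&: W|.
  rewrite /deg -(cardsID (nbrs v) (nbrs w)); congr (_ + #|pred_of_set _|).
  apply/setP=> x; rewrite in_setI in_setD NvW !inE andbC; case wx: (adj w x) => //=.
  apply/idP/andP => [vx|[]//]; split=> //.
  by apply: contraTneq wx => ->; rewrite adj_sym; move: wW; rewrite NvW => /andP[].
have cW1 : #|W :\ w|.+1 = #|W| by rewrite (cardsD1 w W) wW.
have := low w; have := subset_leq_card wWsub => le1 loww.
have /eqP Wsub : nbrs w :&: W == W :\ w by rewrite eqEcard wWsub; lia.
have /card_gt0P[u] : 0 < #|nbrs w :&: nbrs v| by lia.
rewrite !inE => /andP[wu vu].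
have uw : adj u w by rewrite adj_sym.
have cD : conn (w |: [set v; u]) by apply: conn_setU1 (set22 _ _) uw; apply: conn_set2.
apply: leq_trans (mvx_boundary k cG cD).
have c3 : #|w |: [set v; u]| <= 3 by rewrite cardsU1 cards2; lia.
have := cardsC (w |: [set v; u]) => E.
apply: leq_trans (_ : #|~: (w |: [set v; u])|.+1 <= _); first by lia.
rewrite ltnS; apply/subset_leq_card/subsetP=> x; rewrite in_setC => xD.
case: (boolP (adj v x)) => vx; first by apply: in_boundary vx xD; rewrite !inE eqxx orbT.
have : x \in W :\ w.
  by rewrite in_setD1 NvW vx andbT; move: xD; rewrite !inE !negb_or => /and3P[-> ->].
rewrite -Wsub in_setI inE => /andP[wx _].
by apply: in_boundary wx xD; rewrite setU11.
Qed.

End NearRegular.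

(** Both graphs have diameter 2, so each of the two numbers is at least
    [maxn (d + 1) (n - d)] for every degree [d] of [G].  This suffices unless
    [7 <= n] and all degrees of [G], and then also of its complement, are within
    1/2 of [(n - 1) / 2]; in that case [mvx_near_regular] improves one of the two
    numbers by one if [n] is even and both if [n] is odd. *)
Lemma mvx_sum_lower_diam2 (G : sgraph) k : connected_graph G -> connected_graph (compl G) ->
  (forall x y : G, ~ far x y) -> (forall x y : compl G, ~ far x y) -> 6 <= #|G| ->
  #|G| + 2 + (6 < #|G|) <= mvx G k + mvx (compl G) k.
Proof.
move=> cG cH nfG nfH n6.
have near (H : sgraph) : (forall x y : H, ~ far x y) ->
    forall x y : H, y != x -> ~~ adj x y -> exists z, adj x z && adj z y.
  move=> nfar x y yx nxy.
  case: (boolP [exists z, adj x z && adj z y]) => [/existsP//|].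
  rewrite negb_exists => /forallP nz; case: (nfar x y); split=> //; by rewrite eq_sym.
have nC : #|compl G| = #|G| by [].
pose d (x : G) := deg x.
have dc (x : G) : @deg (compl G) x = #|G|.-1 - d x by rewrite deg_compl.
have dlt (x : G) : d x < #|G| by apply: deg_lt.
have G1 x : (d x).+1 <= mvx G k by apply: mvx_deg.
have G2 x : #|G| - d x <= mvx G k by apply: mvx_codeg (near _ nfG x).
have H1 x : (d x).+1 <= mvx (compl G) k.
  have := mvx_codeg k cH (near _ nfH x); rewrite dc nC; have := dlt x; lia.
have H2 x : #|G| - d x <= mvx (compl G) k.
  have := @mvx_deg (compl G) k x cH; rewrite dc; have := dlt x; lia.
case: (boolP [exists x : G, (#|G| < 2 * d x) || (2 * d x + 2 < #|G|)]).
  case/existsP=> x /orP[] dx; move: (G1 x) (G2 x) (H1 x) (H2 x) (dlt x); lia.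
rewrite negb_exists => /forallP reg.
have lo x : #|G| <= 2 * d x + 2 by have := reg x; lia.
have hi x : 2 * d x <= #|G| by have := reg x; lia.
have /card_gt0P[x _] : 0 < #|G| by lia.
case: (ltnP 6 #|G|) => n7; last by move: (G1 x) (G2 x) (H1 x) (H2 x) (dlt x); lia.
have RG v : #|G| <= 2 * d v + 1 -> d v + 2 <= mvx G k.
  by move=> hv; apply: mvx_near_regular; rewrite // ?hi.
have RH v : 2 * d v + 1 <= #|G| -> #|G| - d v + 1 <= mvx (compl G) k.
  move=> hv; have dv := dlt v; have lv := lo v.
  suff : @deg (compl G) v + 2 <= mvx (compl G) k by rewrite dc; lia.
  apply: mvx_near_regular; rewrite ?dc //.
  - by move=> y; rewrite dc; have := hi y; have := dlt y; lia.
  - by lia.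
  by lia.
move: (G1 x) (G2 x) (H1 x) (H2 x) (dlt x) (lo x) (hi x) (RG x) (RH x); lia.
Qed.

(** Whichever of the two graphs has a pair of vertices at distance at least 3
    can play the part of [G] in [mvx_sum_lower_far]. *)
Theorem mvx_sum_lower (G : sgraph) k : connected_graph G -> connected_graph (compl G) ->
  6 <= #|G| ->
  #|G| + 2 + (6 < #|G|) && below_total #|G| k <= mvx G k + mvx (compl G) k.
Proof.
move=> cG cH n6.
have [/existsP[x /existsP[y]]|nfG] := boolP [exists x : G, exists y : G,
   [&& x != y, ~~ adj x y & [forall z, ~~ (adj x z && adj z y)]]].
  case/and3P=> xy nxy /forallP nz; apply: leq_trans (mvx_sum_lower_far k cG cH (And3 xy nxy nz)).
  by rewrite leq_add2l; case: (_ < _).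
have [/existsP[x /existsP[y]]|nfH] := boolP [exists x : compl G, exists y : compl G,
   [&& x != y, ~~ adj x y & [forall z, ~~ (adj x z && adj z y)]]].
  case/and3P=> xy nxy /forallP nz.
  have := @mvx_sum_lower_far (compl G) k x y cH; rewrite connected_compl_compl mvx_compl_compl.
  move=> /(_ cG (And3 xy nxy nz)); rewrite [mvx G k + _]addnC; apply: leq_trans.
  by rewrite leq_add2l; case: (_ < _).
apply: leq_trans (@mvx_sum_lower_diam2 G k cG cH _ _ n6).
- by rewrite leq_add2l; case: (below_total _ _); rewrite ?andbT ?andbF.
- move=> x y [xy nxy nz]; case/negP: nfG; apply/existsP; exists x; apply/existsP; exists y.
  by rewrite xy nxy; apply/forallP.
move=> x y [xy nxy nz]; case/negP: nfH; apply/existsP; exists x; apply/existsP; exists y.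
by rewrite xy nxy; apply/forallP.
Qed.

(** * Paths and their complements *)

Lemma connected_from (G : sgraph) (x0 : G) :
  (forall x, connect (@adj G) x0 x) -> connected_graph G.
Proof.
move=> from0; apply/andP; split; first by apply/card_gt0P; exists x0.
apply/forallP=> x; apply/forallP=> y; apply: connect_trans (from0 y).
by rewrite (sym_connect_sym (@adj_sym G)) from0.
Qed.

(** With [#|G|] colours only stars are monochromatic trees, and a star of the
    complement containing [S] would have a centre without neighbours of [G] in
    [S]. *)
Lemma mvx_compl_total (G : sgraph) k (S : {set G}) : 2 < k <= #|G| ->
  total_dominating S -> #|S| <= k -> mvx (compl G) k <= #|G|.-1.
Proof.
move=> kn tdS Sk; apply: (@mvx_leq (compl G)) => // c cov; rewrite leqNgt; apply/negP=> many.
have ci : injective c.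
  suff : {in G &, injective c} by move=> ci x y; apply: ci.
  apply/imset_injP; rewrite eqn_leq leq_imset_card /=.
  apply: leq_trans (_ : num_colors c <= _); first exact: leq_trans (leqSpred _) many.
  by apply/subset_leq_card/subsetP=> _ /imsetP[x _ ->]; apply/imsetP; exists x.
have [D [cD mD /subsetP SD]] := cov S Sk.
have /set0Pn[d dD] := conn_neq0 cD.
have Dd : D = [set d].
  by apply/setP=> x; rewrite inE; apply/idP/eqP => [xD|->//]; apply: ci; apply: mD.
have [y yS dy] := tdS d; have := SD y yS; rewrite Dd in_setU boundary_set1 inE => /orP[/eqP E|].
  by rewrite E adj_irrefl in dy.
by rewrite inE /= /cadj /= dy andbF.
Qed.

Lemma mvx_le_card (G : sgraph) k : mvx G k <= #|G|.
Proof. by apply/bigmax_leqP=> c _; rewrite /num_colors (leq_trans (leq_imset_card _ _)). Qed.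

Section OrdGraph.
Variables (n : nat) (e : rel nat).
Definition ord_adj : rel 'I_n := [rel i j : 'I_n | (i != j) && (e i j || e j i)].
Lemma ord_adj_sym : symmetric ord_adj.
Proof. by move=> i j; rewrite /ord_adj /= eq_sym orbC. Qed.
Lemma ord_adj_irrefl : irreflexive ord_adj.
Proof. by move=> i; rewrite /ord_adj /= eqxx. Qed.
Definition ord_graph := SGraph ord_adj_sym ord_adj_irrefl.
End OrdGraph.

Definition path_graph n := ord_graph n (fun i j => i.+1 == j).

Section PathGraph.
Variable n : nat.
Let P := path_graph n.

Lemma path_adj (i j : P) : adj i j = (i.+1 == j :> nat) || (j.+1 == i :> nat).
Proof. by rewrite /= /ord_adj /= -val_eqE /=; case: eqP => //= ->; lia. Qed.

Lemma path_conn_convex (D : {set P}) : conn D ->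
  forall i j m : P, i \in D -> j \in D -> i <= m <= j -> m \in D.
Proof.
elim=> [x|{}D x y _ IHD xD].
  by move=> i j m /set1P-> /set1P-> ?; rewrite inE -val_eqE /=; lia.
rewrite path_adj => xy i j m; rewrite !in_setU1.
have eqv (a b : P) : (a == b) = (a == b :> nat) by rewrite -val_eqE.
case/orP=> [/eqP->|iD] /orP[/eqP->|jD] imj.
- by rewrite eqv; apply/orP; left; lia.
- case: (eqVneq m y) => //= my; apply: (IHD x j) => //; rewrite eqv in my; lia.
- case: (eqVneq m y) => //= my; apply: (IHD i x) => //; rewrite eqv in my; lia.
by rewrite (IHD i j) ?orbT.
Qed.

(** A tree containing both ends contains the whole path, so all the vertices
    except the ends get the same colour. *)
Lemma mvx_path k : 3 <= k <= n -> mvx P k <= 3.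
Proof.
move=> k3n; apply: mvx_leq => [|c cov]; first by rewrite card_ord.
have n0 : 0 < n by lia.
have n1 : n.-1 < n by lia.
pose a : P := Ordinal n0; pose b : P := Ordinal n1.
have [|D [cD mD]] := cov [set a; b]; first by rewrite cards2; case: eqP; lia.
rewrite subUset !sub1set => /andP[aD bD].
have [i iD i1] : exists2 i, i \in D & i <= 1.
  move: aD; rewrite inE => /orP[aD|/boundaryP[_ [i iD]]]; first by exists a.
  by rewrite path_adj /= => ia; exists i => //; lia.
have [j jD jn] : exists2 j, j \in D & n <= j.+2.
  move: bD; rewrite inE => /orP[bD|/boundaryP[_ [j jD]]]; first by exists b => //=; lia.
  by rewrite path_adj /= => jb; exists j => //; lia.
apply: leq_trans (_ : #|[set c i; c a; c b]| <= 3); last first.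
  by rewrite -setUA cardsU1 cards2; case: (_ \notin _); case: (_ != _).
apply/subset_leq_card/subsetP=> _ /imsetP[x _ ->]; rewrite !inE.
have [xa|xa] := eqVneq x a; first by rewrite xa eqxx orbT.
have [xb|xb] := eqVneq x b; first by rewrite xb eqxx orbT.
rewrite (mD x i) ?eqxx //; apply: (path_conn_convex cD iD jD).
have := ltn_ord x; move: xa xb; rewrite -!val_eqE /=; lia.
Qed.

Lemma connected_path : 0 < n -> connected_graph P.
Proof.
move=> n0; apply: (@connected_from P (Ordinal n0)) => -[m mn].
elim: m mn => [|m IHm] mn; first by rewrite (_ : Ordinal mn = Ordinal n0) //; apply: val_inj.
apply: connect_trans (IHm (ltnW mn)) _; apply: connect1.
by rewrite path_adj /= eqxx.
Qed.

Lemma connected_compl_path : 4 <= n -> connected_graph (compl P).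
Proof.
move=> n4; have n0 : 0 < n by lia.
have cpl (i j : P) : i.+1 < j \/ j.+1 < i -> @adj (compl P) i j.
  move=> ij; suff : (i != j) && ~~ adj i j by [].
  by rewrite path_adj -val_eqE /=; lia.
apply: (@connected_from (compl P) (Ordinal n0)) => -[[|[|m]] mn].
- by rewrite (_ : Ordinal mn = Ordinal n0) //; apply: val_inj.
(* Vertex 1 is reached from 0 through 3, which is adjacent to neither. *)
- have n3 : 3 < n by lia.
  by apply: (@connect_trans _ _ (Ordinal n3)); apply: connect1; apply: cpl => /=; lia.
by apply: connect1; apply: cpl => /=; lia.
Qed.

(** A minimum total dominating set of the path: the two middle vertices of each
    block of four, and the last vertex but one to take care of the last vertex. *)
Definition path_tds : {set P} :=
  [set i : P | (i %% 4 == 1) || (i %% 4 == 2) || (i.+2 == n)].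

Lemma path_tdsP : 4 <= n -> total_dominating path_tds.
Proof.
move=> n4 v; have vn := ltn_ord v.
case: (boolP ((v %% 4 <= 1) && (v.+1 < n))) => [/andP[v1 vn']|v2].
  exists (Ordinal vn'); last by rewrite path_adj /= eqxx.
  rewrite inE /=; lia.
have vn' : v.-1 < n by lia.
exists (Ordinal vn'); last by rewrite path_adj /=; lia.
rewrite inE /=; lia.
Qed.

End PathGraph.

Lemma card_path_tds n : 2 <= n -> #|path_tds n| = n %/ 2 + (n %% 4 != 0).
Proof.
have sum_mod m : \sum_(i < m) ((i %% 4 == 1) || (i %% 4 == 2)) =
    2 * (m %/ 4) + (m %% 4 == 2) + 2 * (m %% 4 == 3).
  elim: m => [|m IHm]; first by rewrite big_ord0.
  rewrite big_ord_recr /= IHm; do 5 case: eqP => ? /=; lia.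
(* The last two vertices are counted apart, so that on the remaining [m] the
   clause about the last vertex but one is void. *)
case: n => [|[|m]] // _; rewrite -sum1dep_card big_mkcond /= !big_ord_recr /=.
rewrite (eq_bigr (fun i : 'I_m => ((i %% 4 == 1) || (i %% 4 == 2) : nat))) => [|i _].
  rewrite sum_mod eqxx orbT (_ : (m.+3 == m.+2) = false) ?orbF; last by lia.
  by repeat (case: eqP => ? /=); lia.
have := ltn_ord i; rewrite !eqSS => im; rewrite (ltn_eqF im) orbF.
by case: (_ || _).
Qed.

(** * Small extremal graphs and the theorem *)

Lemma conn_no_isolated (G : sgraph) (D : {set G}) x :
  conn D -> x \in D -> D = [set x] \/ exists2 y, y \in D & adj x y.
Proof.
move=> cD; elim: cD x => [x|{}D x y _ IHD xD xy] z; first by move=> /set1P->; left.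
rewrite in_setU1 => /orP[/eqP->|zD]; right.
  by exists x; rewrite // ?in_setU1 ?xD ?orbT // adj_sym.
case: (IHD z zD) => [Dz|[w wD zw]]; last by exists w; rewrite // in_setU1 wD orbT.
exists y; first by rewrite setU11.
by move: xD; rewrite Dz => /set1P<-.
Qed.

(** With at least [#|G| - 1] colours at most one pair [a], [b] of vertices shares
    a colour, so the monochromatic connected sets are the singletons and possibly
    one edge [ab]; a small set [S] outside the reach of all of them refutes such a
    colouring. *)
Lemma mvx_leq_minus2 (G : sgraph) k : 2 < k <= #|G| ->
  (forall a b : G, (a == b) || adj a b -> exists S : {set G},
    [/\ #|S| <= k, forall v, ~~ (S \subset v |: nbrs v)
      & ~~ (S \subset [set a; b] :|: (nbrs a :|: nbrs b))]) ->
  mvx G k <= #|G| - 2.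
Proof.
move=> kn unc; apply: mvx_leq => // c cov; rewrite leqNgt; apply/negP=> many.
have /card_gt0P[g0 _] : 0 < #|G| by lia.
have [|a [b small]] := mono_small (c := c) g0; first by move: many; lia.
pose a' := if adj a b then b else a.
have [|S [Sk Sv Sab]] := unc a a'; first by rewrite /a'; case: ifP => [->|_]; rewrite ?eqxx ?orbT.
have [D [cD mD SD]] := cov S Sk.
have [[v Dv]|[Dab ab]] : (exists v, D = [set v]) \/ (D = [set a; b] /\ adj a b).
  case: (small D (conn_neq0 cD) mD) => [[v Dv]|Dab]; first by left; exists v.
  have aD : a \in D by rewrite Dab set21.
  case: (conn_no_isolated cD aD) => [Da|[y yD ay]]; first by left; exists a.
  right; split=> //; move: yD ay; rewrite Dab => /set2P[]-> //; by rewrite adj_irrefl.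
- by have := Sv v; rewrite -boundary_set1 -Dv SD.
case/negP: Sab; apply: subset_trans SD _; rewrite /a' ab Dab.
apply: setUS; apply/subsetP=> y /boundaryP[_ [x xD xy]].
by case/set2P: xD xy => ->; rewrite !inE => ->; rewrite ?orbT.
Qed.

(** The hypotheses of [mvx_leq_minus2], and the distance condition used for
    connectedness, restated over lists of natural numbers so that they can be
    decided by computation on a concrete graph. *)
Section Check.
Variables (n : nat) (r : rel nat).

Definition escapes (s : seq nat) v := has (fun x => (x != v) && ~~ r v x) s.
Definition escapes2 (s : seq nat) a b :=
  has (fun x => [&& x != a, x != b, ~~ r a x & ~~ r b x]) s.
Definition triples :=
  [seq [:: p.1; p.2; z] | p <- [seq (x, y) | x <- iota 0 n, y <- iota 0 n],
                          z <- iota 0 n].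
Definition uncovered_check :=
  all (fun a => all (fun b => (a == b) || r a b ==>
    has (fun s => all (escapes s) (iota 0 n) && escapes2 s a b) triples) (iota 0 n)) (iota 0 n).
Definition diam2_check :=
  all (fun x => [|| x == 0, r 0 x | has (fun y => r 0 y && r y x) (iota 0 n)]) (iota 0 n).

Variables (e : rel 'I_n) (es : symmetric e) (ei : irreflexive e).
Let G := SGraph es ei.
Hypothesis re : forall i j : 'I_n, e i j = r i j.

Lemma mvx_check k : 2 < k <= n -> uncovered_check -> mvx G k <= n - 2.
Proof.
move=> kn chk; rewrite -[n in n - 2]card_ord; apply: (@mvx_leq_minus2 G); first by rewrite card_ord.
have io (i : G) : (i : nat) \in iota 0 n by rewrite mem_iota /= ltn_ord.
move=> a b ab; have := allP (allP chk _ (io a)) _ (io b).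
rewrite -re -val_eqE in ab *; rewrite ab /= => /hasP[s].
case/allpairsP=> [[[x y] z]] /= [/allpairsP[[x' y'] /= [xn yn [-> ->]]] zn ->] /andP[/allP sv sab].
move: xn yn zn; rewrite !mem_iota /= add0n => xn yn zn.
pose S : {set G} := [set Ordinal xn; Ordinal yn; Ordinal zn].
have inS w : w \in [:: x'; y'; z] -> exists2 u : G, u \in S & w = u.
  rewrite !inE => /or3P[]/eqP->;
    [exists (Ordinal xn) | exists (Ordinal yn) | exists (Ordinal zn)];
    by rewrite // !inE eqxx ?orbT.
exists S; split.
- apply: leq_trans (_ : 3 <= k); last by case/andP: kn.
  by rewrite /S -setUA cardsU1 cards2; case: (_ \notin _); case: (_ != _).
- move=> v; have /hasP[w /inS[u uS ->]] := sv v (io v); rewrite -re val_eqE => uv.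
  by apply/subsetPn; exists u; rewrite // !inE negb_or.
have /hasP[w /inS[u uS ->]] := sab; rewrite -!re !val_eqE => uv.
apply/subsetPn; exists u => //; rewrite !inE !negb_or.
by case/and4P: uv => -> -> -> ->.
Qed.

Lemma connected_check : 0 < n -> diam2_check -> connected_graph G.
Proof.
move=> n0 chk; apply: (@connected_from G (Ordinal n0)) => x.
have := allP chk x; rewrite mem_iota /= ltn_ord => /(_ isT)/or3P[/eqP x0|x0|/hasP[y]].
- by rewrite (_ : x = Ordinal n0) //; apply: val_inj.
- by apply: connect1; rewrite /= re.
rewrite mem_iota /= => yn /andP[y0 yx].
by apply: (@connect_trans _ _ (Ordinal yn)); apply: connect1; rewrite /= re.
Qed.
End Check.

Lemma mvx_sum_sharp_small n (e : rel nat) k :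
  let r := fun i j => (i != j) && (e i j || e j i) in
  let r' := fun i j => (i != j) && ~~ r i j in
  [&& uncovered_check n r, uncovered_check n r', diam2_check n r & diam2_check n r'] ->
  2 < k <= n -> mvx_sum_lower_bound n k (2 * (n - 2)) ->
  mvx_sum_sharp_lower_bound n k (2 * (n - 2)).
Proof.
move=> r r' /and4P[ur ur' dr dr'] kn low; split=> //; exists (ord_graph n e).
have n0 : 0 < n by lia.
have cG : connected_graph (ord_graph n e) by apply: (@connected_check n r).
have cH : connected_graph (compl (ord_graph n e)) by apply: (@connected_check n r').
split=> //; first exact: card_ord.
have upG : mvx (ord_graph n e) k <= n - 2 by apply: (@mvx_check n r).
have upH : mvx (compl (ord_graph n e)) k <= n - 2 by apply: (@mvx_check n r').
have := low _ (card_ord n : #|ord_graph n e| = n) cG cH; lia.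
Qed.

(** Each of the two connected graphs has a vertex of degree at least 2, hence at
    least 3 colours. *)
Lemma mvx_sum_lower5 k : mvx_sum_lower_bound 5 k 6.
Proof.
move=> G nG cG cH; have G3 : 2 < #|G| by rewrite nG.
have [x dx] := exists_deg_ge2 cG G3; have [y dy] := exists_deg_ge2 cH G3.
have := mvx_deg k x cG; have := mvx_deg k y cH; lia.
Qed.

(** The 5-cycle, which is isomorphic to its complement. *)
Lemma mvx_sum_sharp5 k : 3 <= k <= 5 -> mvx_sum_sharp_lower_bound 5 k 6.
Proof.
move=> k5; apply: (@mvx_sum_sharp_small 5 (fun i j => j == i.+1 %% 5)) => //.
exact: mvx_sum_lower5.
Qed.

(** The 5-cycle 0, 1, 5, 2, 4 with the vertex 2 duplicated: vertex 3 has the same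
    two neighbours. *)
Lemma mvx_sum_sharp6 k : 3 <= k <= 6 -> mvx_sum_sharp_lower_bound 6 k 8.
Proof.
move=> k6; apply: (@mvx_sum_sharp_small 6 (fun i j => (i, j) \in
  [:: (0, 1); (0, 4); (1, 5); (2, 4); (2, 5); (3, 4); (3, 5)])) => //.
by move=> G nG cG cH; have := @mvx_sum_lower G k cG cH; rewrite nG; apply.
Qed.

(** The path attains the bound: it has 3 colours, and its complement has [n] or
    [n - 1] according to whether [k] is below the total domination number. *)
Lemma mvx_sum_sharp_ge7 n k : 7 <= n -> 3 <= k <= n ->
  mvx_sum_sharp_lower_bound n k (n + 2 + below_total n k).
Proof.
move=> n7 kn; have low : mvx_sum_lower_bound n k (n + 2 + below_total n k).
  move=> G nG cG cH; have := @mvx_sum_lower G k cG cH; rewrite nG n7 /=; apply; lia.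
split=> //; have nP : #|path_graph n| = n by apply: card_ord.
exists (path_graph n); have cG : connected_graph (path_graph n) by apply: connected_path; lia.
have cH : connected_graph (compl (path_graph n)) by apply: connected_compl_path; lia.
split=> //; apply/eqP; rewrite eqn_leq low // andbT.
have up3 := mvx_path kn.
case bel: (below_total n k).
  have := mvx_le_card (compl (path_graph n)) k; rewrite (nP : #|compl _| = _); lia.
have := @mvx_compl_total (path_graph n) k (path_tds n); rewrite nP kn => H.
suff : mvx (compl (path_graph n)) k <= n.-1 by lia.
apply: H => //; first by apply: path_tdsP; lia.
rewrite card_path_tds; last by lia.
move/negbT: bel; rewrite /below_total negb_or -leqNgt negb_and => /andP[nk].
by case/orP; lia.
Qed.

Theorem theorem4p4 :
  [/\ (* (i) *)
      forall k : nat, 3 <= k <= 5 -> mvx_sum_sharp_lower_bound 5 k 6,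
      (* (ii) *)
      forall k : nat, 3 <= k <= 6 -> mvx_sum_sharp_lower_bound 6 k 8
    & (* (iii) *)
      forall n : nat, 7 <= n ->
      [/\ odd n ->
            (forall k : nat, 3 <= k <= (n - 1) %/ 2 ->
               mvx_sum_sharp_lower_bound n k (n + 3)) /\
            (forall k : nat, (n + 1) %/ 2 <= k <= n ->
               mvx_sum_sharp_lower_bound n k (n + 2)),
          forall t : nat, n = 4 * t ->
            (forall k : nat, 3 <= k <= n %/ 2 - 1 ->
               mvx_sum_sharp_lower_bound n k (n + 3)) /\
            (forall k : nat, n %/ 2 <= k <= n ->
               mvx_sum_sharp_lower_bound n k (n + 2))
        & forall t : nat, n = 4 * t + 2 ->
            (forall k : nat, 3 <= k <= n %/ 2 ->
               mvx_sum_sharp_lower_bound n k (n + 3)) /\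
            (forall k : nat, n %/ 2 + 1 <= k <= n ->
               mvx_sum_sharp_lower_bound n k (n + 2))]].
Proof.
split; [exact: mvx_sum_sharp5 | exact: mvx_sum_sharp6 | move=> n n7].
have sharp k b : 3 <= k <= n -> n + 2 + below_total n k = b ->
    mvx_sum_sharp_lower_bound n k b.
  by move=> kn <-; apply: mvx_sum_sharp_ge7.
rewrite /below_total in sharp.
split=> [on|t nt|t nt]; split=> k kn; apply: sharp; lia.
Qed.
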